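(* Let $A\in\mathbb{K}^{n\times n}$. Suppose $\mathcal{X}_c$ is an invariant subspace of $A$ of dimension $p$ with $AX_c=X_c\Lambda_c$, where $X_c\in\mathbb{K}^{n\times p}$ is a full rank matrix with $\mathfrak{R}(X_c)=\mathcal{X}_c$ and $\Lambda_c\in\mathbb{K}^{p\times p}$. (i) The matrices $\Delta A\in\mathbb{K}^{n\times n}$ for which $\mathcal{X}_c$ remains an invariant subspace of $A+\Delta A$ are exactly those of the form $$\Delta A=X_c(R\Lambda_a-\Lambda_cR)(X_cR)^\dagger+Z\left(I-X_cR(X_cR)^\dagger\right)$$ for some $\Lambda_a\in\mathbb{K}^{p\times p}$ and some nonsingular $R\in\mathbb{K}^{p\times p}$, where $Z\in\mathbb{K}^{n\times n}$ is arbitrary. (ii) In addition, let $\mathcal{X}_f$ be an invariant subspace of $A$ such that $\mathcal{X}_c\oplus\mathcal{X}_f=\mathbb{K}^n$. Let $X_a\in\mathbb{K}^{n\times p}$ and $X_f\in\mathbb{K}^{n\times(n-p)}$ be full rank matrices with $\mathfrak{R}(X_a)=\mathcal{X}_c$ and $\mathfrak{R}(X_f)=\mathcal{X}_f$. Then the matrices $\Delta A\in\mathbb{K}^{n\times n}$ for which $\mathcal{X}_c$ and $\mathcal{X}_f$ are complementary invariant subspaces of $A+\Delta A$ are exactly those of the form $$\Delta A=\begin{bmatrix}X_a\hat{\Lambda}_a-AX_a & X_f\hat{\Lambda}_f-AX_f\end{bmatrix}\begin{bmatrix}X_a & X_f\end{bmatrix}^{-1}$$ for some $\hat{\Lambda}_a\in\mathbb{K}^{p\times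 p}$ and $\hat{\Lambda}_f\in\mathbb{K}^{(n-p)\times(n-p)}$.
   Context: $\mathbb{K}\in\{\mathbb{R},\mathbb{C}\}$. $X^\dagger$ is the Moore-Penrose pseudoinverse of $X$, $\mathfrak{R}(X)$ is the column space of $X$, and $I$ is the identity matrix of order $n$. A subspace $\mathcal{X}$ is invariant for a matrix $M$ if $M\mathcal{X}\subseteq\mathcal{X}$; two invariant subspaces are complementary if their direct sum is $\mathbb{K}^n$. *)

(* Defs.v *)
From HB Require Import structures.
From mathcomp Require Import all_boot all_order all_algebra.
From mathcomp Require Import complex reals.

Set Implicit Arguments.
Unset Strict Implicit.
Unset Printing Implicit Defensive.

Import Order.TTheory GRing.Theory Num.Theory.

Local Open Scope ring_scope.
Local Open Scope complex_scope.
Local Open Scope sesquilinear_scope.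

Variant base_field := RealNumbers | ComplexNumbers.

Definition scalar_field (R : realType) (k : base_field) : numFieldType :=
  match k with
  | RealNumbers => R : numFieldType
  | ComplexNumbers => R[i] : numFieldType
  end.

Definition conj_scalar (R : realType) (k : base_field) :
    {rmorphism scalar_field R k -> scalar_field R k} :=
  match k with
  | RealNumbers => idfun : {rmorphism R -> R}
  | ComplexNumbers => @conjc R : {rmorphism R[i] -> R[i]}
  end.

Lemma conj_scalarK R k : involutive (@conj_scalar R k).
Proof. by case: k => //= x; exact: conjcK. Qed.

Lemma conj_scalar_normr R k (x : scalar_field R k) :
  conj_scalar R k x * x = `|x| ^+ 2.
Proof.
case: k x => /= x; first by rewrite real_normK ?num_real.
by rewrite mulrC sqr_normc.
Qed.

Section MoorePenrose.
Variables (R : realType) (k : base_field).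
Local Notation K := (scalar_field R k).
Local Notation "M ^H" := (M ^t (conj_scalar R k)) (at level 8, format "M ^H").

(* The four Penrose equations; they have exactly one solution Y, by
   moore_penrose_exists and moore_penrose_unique. *)
Definition moore_penrose m n (X : 'M[K]_(m, n)) (Y : 'M[K]_(n, m)) : bool :=
  [&& X *m Y *m X == X,
      Y *m X *m Y == Y,
      (X *m Y)^H == X *m Y
    & (Y *m X)^H == Y *m X].

Lemma adjmxM m n p (X : 'M[K]_(m, n)) (Y : 'M[K]_(n, p)) :
  (X *m Y)^H = Y^H *m X^H.
Proof. by rewrite trmx_mul map_mxM. Qed.

Lemma adjmxK m n (X : 'M[K]_(m, n)) : (X^H)^H = X.
Proof. by apply/matrixP=> i j; rewrite !mxE conj_scalarK. Qed.

Lemma gram_unit m n (X : 'M[K]_(m, n)) : row_free X -> X *m X^H \in unitmx.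
Proof.
move=> fX; rewrite -row_free_unit -kermx_eq0; apply/rowV0P => v /sub_kermxP.
rewrite mulmxA => vX0.
have {}vX0 : (v *m X) *m (v *m X)^H = 0.
  by rewrite adjmxM mulmxA vX0 mul0mx.
move/matrixP/(_ 0 0): vX0; rewrite !mxE => vX0.
have {}vX0 : v *m X = 0.
  apply/rowP => j; rewrite [RHS]mxE; apply/eqP.
  move: vX0 => /eqP; rewrite psumr_eq0 => [|i _]; last first.
    by rewrite !mxE mulrC conj_scalar_normr exprn_ge0.
  by move=> /allP /(_ j (mem_index_enum _)); rewrite !mxE mulrC
    conj_scalar_normr sqrf_eq0 normr_eq0 => /eqP ->.
by apply: (row_free_inj fX); rewrite vX0 mul0mx.
Qed.

Lemma invmx_adj n (G : 'M[K]_n) : G^H = G -> (invmx G)^H = invmx G.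
Proof. by move=> hG; rewrite trmx_inv map_invmx hG. Qed.

Lemma moore_penrose_factorization m r n (C : 'M[K]_(m, r)) (F : 'M[K]_(r, n)) :
  row_full C -> row_free F ->
  moore_penrose (C *m F)
    (F^H *m invmx (F *m F^H) *m invmx (C^H *m C) *m C^H).
Proof.
move=> fC fF.
have uF : F *m F^H \in unitmx by apply: gram_unit.
have uC : C^H *m C \in unitmx.
  rewrite -[X in _ *m X](adjmxK C); apply: gram_unit.
  by rewrite /row_free mxrank_map mxrank_tr.
have hF : (F *m F^H)^H = F *m F^H by rewrite adjmxM adjmxK.
have hC : (C^H *m C)^H = C^H *m C by rewrite adjmxM adjmxK.
set Y := _ *m C^H.
have XY : C *m F *m Y = C *m invmx (C^H *m C) *m C^H.
  by rewrite /Y !mulmxA -(mulmxA C F) -(mulmxA C) mulmxV // mulmx1.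
have YX : Y *m (C *m F) = F^H *m invmx (F *m F^H) *m F.
  by rewrite /Y !mulmxA -(mulmxA _ C^H C) -(mulmxA _ _ (C^H *m C)) mulVmx //
    mulmx1.
apply/and4P; split; apply/eqP.
- by rewrite XY !mulmxA -(mulmxA _ C^H C) -(mulmxA C) mulVmx // mulmx1.
- rewrite YX /Y !mulmxA -(mulmxA _ F F^H) -(mulmxA _ _ (F *m F^H)).
  by rewrite mulVmx // mulmx1.
- by rewrite XY !adjmxM adjmxK invmx_adj // mulmxA.
- by rewrite YX !adjmxM adjmxK invmx_adj // mulmxA.
Qed.

Lemma moore_penrose_exists m n (X : 'M[K]_(m, n)) : exists Y, moore_penrose X Y.
Proof.
have := moore_penrose_factorization (col_base_full X) (row_base_free X).
by rewrite mulmx_base; move=> ?; eexists; eassumption.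
Qed.

Definition pseudoinverse m n (X : 'M[K]_(m, n)) : 'M[K]_(n, m) :=
  xchoose (moore_penrose_exists X).

Lemma pseudoinverseP m n (X : 'M[K]_(m, n)) : moore_penrose X (pseudoinverse X).
Proof. exact: xchooseP. Qed.

Lemma moore_penrose_unique m n (X : 'M[K]_(m, n)) Y Z :
  moore_penrose X Y -> moore_penrose X Z -> Y = Z.
Proof.
case/and4P=> /eqP y1 /eqP y2 /eqP y3 /eqP y4.
case/and4P=> /eqP z1 /eqP z2 /eqP z3 /eqP z4.
have e1 : X *m Y = X *m Z.
  by rewrite -y3 -[X in (X *m Y)^H]z1 -(mulmxA _ X) adjmxM y3 z3 mulmxA y1.
have e2 : Y *m X = Z *m X.
  by rewrite -y4 -[X in (Y *m X)^H]z1 -mulmxA mulmxA adjmxM y4 z4 -mulmxA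
     (mulmxA X) y1.
by rewrite -y2 -mulmxA e1 mulmxA e2 z2.
Qed.

End MoorePenrose.

Section Subspaces.
Variable K : fieldType.

Definition colspace m n (X : 'M[K]_(m, n)) : {vspace 'cV[K]_m} :=
  <<[seq col j X | j : 'I_n]>>%VS.

Definition full_rank m n (X : 'M[K]_(m, n)) : Prop := \rank X = minn m n.

(* Matrices act on column vectors, so the row-space notions of mxalgebra
   (stablemx, submx, ...) are not used here. *)
Definition invariant_subspace n (M : 'M[K]_n) (U : {vspace 'cV[K]_n}) : Prop :=
  (linfun (mulmx M) @: U <= U)%VS.

Definition complementary_subspaces n (U V : {vspace 'cV[K]_n}) : Prop :=
  directv (U + V) /\ (U + V)%VS = fullv.

Definition complementary_invariant_subspaces n (M : 'M[K]_n)
    (U V : {vspace 'cV[K]_n}) : Prop :=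
  [/\ invariant_subspace M U, invariant_subspace M V
    & complementary_subspaces U V].

End Subspaces.

(* Main.v *)
(* The column space of X is M-invariant iff M X = X L for some L.  For (i),
   (X_c R)^dagger is a left inverse of X_c R, so the displayed DeltaA satisfies
   (A + DeltaA) X_c R = X_c R Lambda_a; conversely take R = I and Z = DeltaA.
   For (ii), [X_a X_f] is invertible by complementarity, so DeltaA is determined
   by its products with X_a and X_f. *)
Require Import Defs.
From mathcomp Require Import all_boot all_order all_algebra.
From mathcomp Require Import complex reals.

Import GRing.Theory.

Local Open Scope ring_scope.

Section Colspace.
Variable K : fieldType.

Lemma mem_colspace {m n} (X : 'M[K]_(m, n)) v :
  (v \in colspace X) <-> (exists c : 'cV[K]_n, v = X *m c).
Proof.
split=> [/coord_span ->|[c ->]].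
  elim/big_ind: _ => [|_ _ [c ->] [d ->]|i _].
  - by exists 0; rewrite mulmx0.
  - by exists (c + d); rewrite mulmxDr.
  (* The spanning list is indexed by position, so its [i]-th entry is first recognised as some
     column [j] of [X], that is, [X] times a unit vector. *)
  have /mapP[j _ ->] : [seq col j X | j : 'I_n]`_i \in [seq col j X | j : 'I_n].
    by rewrite mem_nth // size_image.
  by exists (coord [tuple of [seq col j X | j : 'I_n]] i v *: delta_mx j 0); rewrite colE scalemxAr.
have -> : X *m c = \sum_j c j 0 *: col j X.
  apply/colP=> i; rewrite mxE summxE; apply: eq_bigr => j _.
  by rewrite !mxE mulrC.
by apply: memv_suml => j _; apply/memvZ/memv_span/image_f.
Qed.

Lemma cols_in_colspace {m n r} (X : 'M[K]_(m, n)) (M : 'M[K]_(m, r)) :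
  (forall j, col j M \in colspace X) <-> (exists L, M = X *m L).
Proof.
split=> [MX|[L ->] j]; last first.
  by apply/mem_colspace; exists (col j L); rewrite !colE mulmxA.
have /fin_all_exists[c Mc] j : exists c : 'cV_n, col j M = X *m c.
  exact/mem_colspace.
exists (\matrix_(i, j) c j i 0); apply/matrixP=> i j.
have /colP/(_ i) := Mc j; rewrite !mxE => ->.
by apply: eq_bigr => l _; rewrite mxE.
Qed.

(** By linearity it suffices to test [M] on the columns of [X], and their images are the columns of
    [M *m X]. *)
Lemma invariant_colspace {m n} (M : 'M[K]_m) (X : 'M[K]_(m, n)) :
  invariant_subspace M (colspace X) <-> (exists L, M *m X = X *m L).
Proof.
rewrite -cols_in_colspace; split=> [/subvP MX j|MX].
  have -> : col j (M *m X) = linfun (mulmx M) (col j X).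
    by rewrite lfunE /= !colE mulmxA.
  exact/MX/memv_img/memv_span/image_f.
have /cols_in_colspace[L ML] := MX.
apply/subvP=> _ /memv_imgP[_ /mem_colspace[c ->] ->].
by apply/mem_colspace; exists (L *m c); rewrite lfunE /= !mulmxA ML.
Qed.

(** Splitting each column of the identity along the two spaces gives a right inverse of
    [row_mx X Y], which is square. *)
Lemma row_mx_colspace_unit p q (X : 'M[K]_(p + q, p)) (Y : 'M[K]_(p + q, q)) :
  (colspace X + colspace Y)%VS = fullv -> row_mx X Y \in unitmx.
Proof.
move=> XYf; suff /cols_in_colspace[L /esym/mulmx1_unit[]//] :
  forall j, col j 1%:M \in colspace (row_mx X Y).
move=> j; have := memvf (col j 1%:M : 'cV[K]_(p + q)).
rewrite -XYf => /memv_addP[_ /mem_colspace[c ->] [_ /mem_colspace[d ->] ->]].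
by apply/mem_colspace; exists (col_mx c d); rewrite mul_row_col.
Qed.

End Colspace.

(** Full column rank gives some left inverse of [X]; it cancels the leftmost [X] in the first
    Penrose equation. *)
Lemma pseudoinverse_mull {R : realType} {k : base_field} {m n}
    (X : 'M[scalar_field R k]_(m, n)) :
  row_full X -> pseudoinverse X *m X = 1%:M.
Proof.
move=> fX; have /and4P[/eqP XYX _ _ _] := pseudoinverseP X.
by rewrite -[LHS]mul1mx -(mulVpmx fX) -mulmxA [X *m _]mulmxA XYX.
Qed.

(* The order of A is written n = p + q, so that q is n - p. *)
Theorem theorem2p2 (R : realType) (k : base_field) (p q : nat)
    (A : 'M[scalar_field R k]_(p + q))
    (Xc_sp : {vspace 'cV[scalar_field R k]_(p + q)})
    (Xc : 'M[scalar_field R k]_(p + q, p)) (Lc : 'M[scalar_field R k]_p) :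
  invariant_subspace A Xc_sp ->
  \dim Xc_sp = p ->
  A *m Xc = Xc *m Lc ->
  full_rank Xc ->
  colspace Xc = Xc_sp ->
  (forall DA : 'M[scalar_field R k]_(p + q),
     invariant_subspace (A + DA) Xc_sp <->
     exists (La S : 'M[scalar_field R k]_p) (Z : 'M[scalar_field R k]_(p + q)),
       S \in unitmx /\
       DA = Xc *m (S *m La - Lc *m S) *m pseudoinverse (Xc *m S)
            + Z *m (1%:M - Xc *m S *m pseudoinverse (Xc *m S)))
  /\
  (forall (Xf_sp : {vspace 'cV[scalar_field R k]_(p + q)})
      (Xa : 'M[scalar_field R k]_(p + q, p))
      (Xf : 'M[scalar_field R k]_(p + q, q)),
     invariant_subspace A Xf_sp ->
     complementary_subspaces Xc_sp Xf_sp ->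
     full_rank Xa -> colspace Xa = Xc_sp ->
     full_rank Xf -> colspace Xf = Xf_sp ->
     forall DA : 'M[scalar_field R k]_(p + q),
       complementary_invariant_subspaces (A + DA) Xc_sp Xf_sp <->
       exists (La : 'M[scalar_field R k]_p) (Lf : 'M[scalar_field R k]_q),
         DA = row_mx (Xa *m La - A *m Xa) (Xf *m Lf - A *m Xf)
              *m invmx (row_mx Xa Xf)).
Proof.
move=> _ _ AXc Xc_full XcE; have fXc : row_full Xc.
  by rewrite /row_full Xc_full; apply/eqP/minn_idPr/leq_addr.
split=> [DA|Xf_sp Xa Xf _ Xc_Xf _ XaE _ XfE DA].
  rewrite -XcE invariant_colspace; split=> [[L DAXc]|[La [S [Z [uS ->]]]]].
    exists L, 1%:M, DA; rewrite unitmx1 !mulmx1 mul1mx; split=> //.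
    (* The first term is thus [DA *m Xc *m pseudoinverse Xc], which the [Z] term completes to
       [DA]. *)
    have -> : Xc *m (L - Lc) = DA *m Xc.
      by rewrite mulmxBr -DAXc -AXc mulmxDl addrC addKr.
    by rewrite mulmxBr !mulmx1 mulmxA addrC subrK.
  set X := Xc *m S; have PX : pseudoinverse X *m X = 1%:M.
    by apply: pseudoinverse_mull; rewrite /row_full mxrankMfree ?row_free_unit.
  set E := (E in A + E); have EX : (A + E) *m X = X *m La.
    (* By [PX] the [Z] term kills [X], and [A *m Xc = Xc *m Lc] cancels the [Lc *m S] part. *)
    rewrite /E !mulmxDl -!(mulmxA _ _ X) mulmxBl mul1mx -(mulmxA X) PX !mulmx1.
    by rewrite subrr mulmx0 addr0 mulmxBr /X !mulmxA AXc addrC subrK.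
  (* Passing from the basis [Xc *m S] back to [Xc] conjugates [La] by [S]. *)
  exists (S *m La *m invmx S); apply: (can_inj (mulmxK uS)).
  by rewrite /= -(mulmxA _ Xc S) EX !mulmxA mulmxKV.
rewrite -XaE -XfE in Xc_Xf *; set P := row_mx Xa Xf.
have uP : P \in unitmx by apply: row_mx_colspace_unit; case: Xc_Xf.
(* Complementarity does not involve [DA], so only the two invariance conditions remain, joined here
   into one block equation. *)
transitivity (exists La Lf, (A + DA) *m P = row_mx (Xa *m La) (Xf *m Lf)).
  rewrite /complementary_invariant_subspaces mul_mx_row.
  split=> [[/invariant_colspace[La ->] /invariant_colspace[Lf ->] _]|].
    by exists La, Lf.
  move=> [La [Lf /eq_row_mx[LaE LfE]]].
  by split=> //; apply/invariant_colspace; [exists La | exists Lf].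
split=> -[La [Lf]] => [PE|->]; exists La, Lf.
  apply: (can_inj (mulmxK uP)); rewrite mulmxKV //.
  have -> : DA *m P = (A + DA) *m P - A *m P by rewrite mulmxDl addrC addKr.
  by rewrite PE mul_mx_row opp_row_mx add_row_mx.
by rewrite mulmxDl mulmxKV // mul_mx_row add_row_mx !subrKC.
Qed.
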